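(* Let $V$ be a finite vertex set, $\Pi^2=(U,W)$ a partition of $V$ into two classes, $k\in\mathbb{N}$, and $\mathbf{d}$ a degree sequence on $V$. For every two graphs $G,G'$ on the vertex set $V$ that have the same degree sequence $\mathbf{d}$ and are both consistent with the same skeleton graph $\mathcal{S}=\mathcal{S}(k)$ (on the partition $\Pi^2$), there exists a sequence of $\mathcal{S}$-preserving swaps and $\mathcal{S}$-preserving double swaps that turns $G$ into $G'$.
   Context: Graphs are finite and simple. Given a degree sequence $\mathbf{d}$ on $V$, a partition $(U,W)$ of $V$ and $k\in\mathbb{N}$, the skeleton graph $\mathcal{S}(k)$ has the classes $U,W$ as vertices, a bone $UW$ of weight $k$, and a loop at each class with weight forced by $\mathbf{d}$ and $k$. A graph $G$ on $V$ with degree sequence $\mathbf{d}$ is consistent with $\mathcal{S}(k)$ if $G$ has exactly $k$ edges between $U$ and $W$ (the numbers of edges inside $U$ and inside $W$ are then determined and equal the loop weights). Swap: if $a,b,c,d$ are (distinct) vertices of $G=(V,E)$ with $ab,cd\in E$ and $bc,ad\notin E$, the swap $ab,cd\Rightarrow bc,ad$ replaces $G$ by $(V,(E\cup\{bc,ad\})\setminus\{ab,cd\})$. Double swap: the simultaneous application of two disjoint swaps, i.e. if $a,b,c,d,e,f,g,h$ are eight distinct vertices of $G=(V,E)$ with $ab,cd,ef,gh\in E$ and $bc,ad,fg,eh\notin E$, the double swap $ab,cd,ef,gh\Rightarrow bc,ad,fg,eh$ replaces $G$ by $(V,(E\cup\{bc,ad,fg,eh\})\setminus\{ab,cd,ef,gh\})$.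 A swap or double swap is $\mathcal{S}$-preserving if the graphs before and after the operation are both consistent with $\mathcal{S}$. *)

(* Defs.v *)
From HB Require Import structures.
From mathcomp Require Import all_boot.

Set Implicit Arguments.
Unset Strict Implicit.
Unset Printing Implicit Defensive.

Section Graphs.
Variable V : finType.

Record graph := Graph {
  edges :> {set {set V}};
  edgesP : [forall e in edges, #|e| == 2]
}.

HB.instance Definition _ := [isSub for edges].
HB.instance Definition _ := [Finite of graph by <:].

Implicit Types (G H : graph) (U W : {set V}) (d : V -> nat).

Definition degree G (v : V) : nat := #|[set e in edges G | v \in e]|.

Definition has_degree_sequence d G : Prop := forall v, degree G v = d v.

(* Since edges have two elements, [edges_between G U U] is the set of edges
   inside [U]. *)
Definition edges_between G U W : {set {set V}} :=
  edges G :&: [set [set u; w] | u in U, w in W].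

Record skeleton := Skeleton {
  class1 : {set V};
  class2 : {set V};
  bone : nat;
  loop1 : nat;
  loop2 : nat
}.

(* The degree sum over a class counts each inner edge twice and each edge
   leaving the class once; see [consistent_loops]. *)
Definition loop_weight d U (k : nat) : nat := (\sum_(v in U) d v - k)./2.

Definition skeleton_of d U W (k : nat) : skeleton :=
  Skeleton U W k (loop_weight d U k) (loop_weight d W k).

(* Meant for graphs with the degree sequence of the skeleton, for which the
   loop weights are then met automatically: see [consistent_loops]. *)
Definition consistent (S : skeleton) G : bool :=
  #|edges_between G (class1 S) (class2 S)| == bone S.

Definition swap_at (a b c d : V) G H : bool :=
  [&& uniq [:: a; b; c; d],
      [set a; b] \in edges G, [set c; d] \in edges G,
      [set b; c] \notin edges G, [set a; d] \notin edges G
    & edges H == (edges G :|: [set [set b; c]; [set a; d]])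
                   :\: [set [set a; b]; [set c; d]]].

Definition swap G H : bool :=
  [exists a, exists b, exists c, exists d, swap_at a b c d G H].

Definition double_swap_at (a b c d e f g h : V) G H : bool :=
  [&& uniq [:: a; b; c; d; e; f; g; h],
      [&& [set a; b] \in edges G, [set c; d] \in edges G,
          [set e; f] \in edges G & [set g; h] \in edges G],
      [&& [set b; c] \notin edges G, [set a; d] \notin edges G,
          [set f; g] \notin edges G & [set e; h] \notin edges G]
    & edges H ==
        (edges G :|: [set [set b; c]; [set a; d]; [set f; g]; [set e; h]])
          :\: [set [set a; b]; [set c; d]; [set e; f]; [set g; h]]].

Definition double_swap G H : bool :=
  [exists a, exists b, exists c, exists d,
   exists e, exists f, exists g, exists h, double_swap_at a b c d e f g h G H].

Definition preserving_step (S : skeleton) G H : bool :=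
  [&& consistent S G, consistent S H & swap G H || double_swap G H].

Lemma sum_degree G U :
  \sum_(v in U) degree G v = \sum_(e in edges G) #|e :&: U|.
Proof.
under eq_bigr => v _ do rewrite /degree -sum1_card.
under [RHS]eq_bigr => e _ do rewrite -sum1_card.
rewrite (exchange_big_dep (mem (edges G))) /=; last first.
  by move=> v e _; rewrite inE => /andP[].
apply: eq_bigr => e eG; apply: eq_bigl => v.
by rewrite !inE eG andbC.
Qed.

Lemma card_edgeI G U W e : partition [set U; W] [set: V] -> U != W ->
  e \in edges G ->
  #|e :&: U| = (e \in edges_between G U U).*2 + (e \in edges_between G U W).
Proof.
move=> /and3P[/eqP covUW /trivIsetP triv _] UW eG.
have disUW : [disjoint U & W] by apply: triv => //; rewrite !inE eqxx ?orbT.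
have inW x : (x \in W) = (x \notin U).
  have := in_setT x; rewrite -covUW /cover bigcup_setU !big_set1 inE.
  case xU: (x \in U) => //= _.
  by apply/negP => xW; rewrite (disjointFr disUW xU) in xW.
have /forall_inP/(_ e eG)/cards2P[x [y [xy De]]] := edgesP G.
rewrite {e}De in eG *.
rewrite /edges_between !inE eG /=.
have hUU : ([set x; y] \in [set [set u; w] | u in U, w in U])
    = (x \in U) && (y \in U).
  apply/imset2P/andP => [[u w uU wU E]|[xU yU]]; last by exists x y.
  have := set21 x y; have := set22 x y; rewrite E !inE.
  by move=> /orP[] /eqP-> /orP[] /eqP->; rewrite ?uU ?wU.
have hUW : ([set x; y] \in [set [set u; w] | u in U, w in W])
    = (x \in U) (+) (y \in U).
  apply/imset2P/idP => [[u w uU wW E]|].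
    have wU : w \notin U by rewrite -inW.
    have := set21 x y; have := set22 x y; rewrite E !inE => ya xa.
    case/orP: xa ya xy => /eqP-> /orP[] /eqP->;
      by rewrite ?eqxx // uU (negPf wU).
  case xU: (x \in U); case yU: (y \in U) => //= _.
    by exists x y; rewrite // inW yU.
  by exists y x; rewrite ?inW ?xU // setUC.
rewrite hUU hUW setIUl cardsU -setIIl.
have -> : [set x] :&: [set y] = set0.
  by apply/setP => z; rewrite !inE; case: eqP => // ->; rewrite (negPf xy).
rewrite set0I cards0 subn0.
have h1 z : #|[set z] :&: U| = (z \in U).
  case zU: (z \in U).
    by rewrite (setIidPl _) ?cards1 // sub1set.
  by apply/eqP; rewrite cards_eq0 setI_eq0 disjoints1 zU.
by rewrite !h1; case: (x \in U); case: (y \in U).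
Qed.

Lemma consistent_loops d U W k G :
  partition [set U; W] [set: V] -> U != W ->
  has_degree_sequence d G -> consistent (skeleton_of d U W k) G ->
  #|edges_between G U U| = loop1 (skeleton_of d U W k) /\
  #|edges_between G W W| = loop2 (skeleton_of d U W k).
Proof.
have aux A B : partition [set A; B] [set: V] -> A != B ->
    has_degree_sequence d G ->
    #|edges_between G A A| = loop_weight d A #|edges_between G A B|.
  move=> pAB nAB dG; rewrite /loop_weight.
  rewrite -(eq_bigr _ (fun v _ => dG v)) sum_degree.
  rewrite (eq_bigr _ (fun e eG => card_edgeI pAB nAB eG)) big_split /=.
  have cnt C : \sum_(e in edges G) (e \in edges_between G A C : nat)
      = #|edges_between G A C|.
    rewrite -sum1_card [RHS]big_mkcond [LHS]big_mkcond /=.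
    apply: eq_bigr => e _; rewrite /edges_between inE.
    by case: (e \in edges G) => //=; case: (e \in _).
  under eq_bigr => e _ do rewrite -mul2n.
  by rewrite -big_distrr /= !cnt mul2n addnK doubleK.
move=> pUW nUW dG /eqP /= bG.
have bGC : edges_between G W U = edges_between G U W.
  rewrite /edges_between; congr (_ :&: _); apply/setP => e.
  by apply/imset2P/imset2P => -[x y xA yA ->]; exists y x => //; rewrite setUC.
split; first by rewrite -bG; apply: aux.
by rewrite -bG -bGC; apply: aux => //; rewrite 1?setUC 1?eq_sym.
Qed.

End Graphs.

(* Main.v *)
Require Import Defs.
From mathcomp Require Import all_boot zify.

(** Take the pair G, G' at minimal distance (size of the symmetric difference
    of the edge sets) among all pairs reachable from the two given graphs by
    preserving moves. The proof shows that a minimal pair is equal. Call the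
    edges of G only red, those of G' only blue; every vertex has as many red as
    blue edges, and as many red as blue edges cross between the classes.

    Colours and types (red_cross). Suppose ab is red, bc is blue, and both
    cross or both lie inside a class. For each red cd the alternating path
    a b c d can be closed to a preserving swap, in G or in G', that decreases
    the distance, unless ad is red too. So the red neighbours of c are red
    neighbours of a, up to a and c themselves, and as b is red for a only, c
    has fewer red edges than a. With the colours exchanged, a has fewer blue
    edges than c: a contradiction, since red and blue degrees agree. Hence at
    each vertex the differing edges of one colour all cross and those of the
    other colour all lie inside. The exclusive or of colour and crossing,
    the kind of an edge, is therefore constant on the edges at a vertex
    (kind_const), so that the edges of the two kinds have no common vertex;
    both kinds occur as the red and blue crossing edges are equinumerous.

    A swap to spare (spare_exists). In either kind, the two ends of a crossing
    edge have inside edges of the other colour, and this path of three edges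
    closes to a swap that decreases the distance, in G or in G', but changes the
    number of crossing edges by two. By symmetry suppose that this happens in
    G'. A swap of G' on vertices of the other kind which changes the crossing
    number in the opposite direction can be combined with it to a preserving
    double swap, the two vertex sets being disjoint. So by minimality no such
    swap of G' has three differing pairs of vertices on its 4-cycle, and none
    has four of them after one preliminary preserving swap, which increases
    the distance by at most 4 (spare_flip2, shifted_flip2).

    Descent (no_outer). Write o for crossing and i for inside edges of the
    other kind. In G' all the former have one status p (present or absent) and
    all the latter the opposite status. Along a walk b -o- c -i- d -o- z -i- y,
    if b <> z, then bz has status p, and any v in the class of b for which yv
    has status p but bv has not gives a preserving swap on y, v, b, z after which
    b c d z is a 4-cycle of differing edges. So the number of status-p neighbours
    within the class is smaller at y than at b (nbrs_lt). If b = z, a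
    similar argument on y, v, b, c shows that it is not larger (nbrs_triangle).
    Two consecutive steps cannot both return (triangle_common), so along
    an endless walk these numbers would decrease for ever. *)

Set Implicit Arguments.
Unset Strict Implicit.
Unset Printing Implicit Defensive.

(** * Toggling edges *)

Section Flips.
Variable V : finType.
Implicit Types (G H : graph V) (s : seq {set V}) (a b c d x y v : V).

Definition adj G x y : bool := [set x; y] \in edges G.

Lemma adjC G x y : adj G x y = adj G y x.
Proof. by rewrite /adj setUC. Qed.

Lemma edge_card2 G (e : {set V}) : e \in edges G -> #|e| == 2.
Proof. by move=> eG; apply: (forall_inP (edgesP G)). Qed.

Lemma adj_irr G x : adj G x x = false.
Proof. by apply/negP => /edge_card2; rewrite setUid cards1. Qed.

Lemma eq_set2 a b x y :
  ([set x; y] == [set a; b]) = (x == a) && (y == b) || (x == b) && (y == a).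
Proof.
apply/eqP/idP => [E|/orP[]/andP[/eqP-> /eqP->]//]; last by rewrite setUC.
have := set21 x y; have := set22 x y; rewrite E !inE.
have := set21 a b; have := set22 a b; rewrite -E !inE.
rewrite ![a == _]eq_sym ![b == _]eq_sym.
by case: (x == a) (x == b) (y == a) (y == b) => [] [] [] [].
Qed.

Lemma degreeE G v : degree G v = #|[set x | adj G v x]|.
Proof.
rewrite /degree -(card_imset _ (f := fun x => [set v; x])); last first.
  move=> x y /eqP; rewrite eq_set2 eqxx /=.
  by case/orP=> [/eqP//|/andP[/eqP-> /eqP->]].
apply: eq_card => e; rewrite inE; apply/andP/imsetP => [[eG ve]|[x]]; last first.
  by rewrite inE => ax ->; rewrite set21.
have /cards2P[x [y [_ De]]] := edge_card2 eG.
move: ve; rewrite De !inE => /orP[]/eqP Dv; subst v.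
  by exists y; rewrite // inE /adj -De.
by exists x; rewrite 1?setUC // inE /adj setUC -De.
Qed.

(** Moves are treated as toggles of a list of edges: as toggling ignores which
    edges are present, one argument serves a move, its inverse and its
    counterpart in the complement. *)
Definition flip G s H : bool :=
  edges H == [set e | (e \in edges G) (+) (e \in s)].

Lemma flipE G s H e : flip G s H -> (e \in edges H) = (e \in edges G) (+) (e \in s).
Proof. by move=> /eqP->; rewrite inE. Qed.

Lemma flip_sym G s H : flip G s H -> flip H s G.
Proof. by move=> F; apply/eqP/setP=> e; rewrite inE (flipE e F) addbK. Qed.

Lemma flip_exists G s :
  all (fun e : {set V} => #|e| == 2) s -> exists H, flip G s H.
Proof.
move=> /allP s2.
have P : [forall e in [set e | (e \in edges G) (+) (e \in s)], #|e| == 2].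
  apply/forall_inP => e; rewrite inE => eGs.
  case eG: (e \in edges G) eGs => /= eGs; first exact: edge_card2 eG.
  exact: (s2 e eGs).
by exists (Graph P); rewrite /flip eqxx.
Qed.

(** Toggling [s] removes the elements of [s] that are in [D] and adds the
    others; subtraction is avoided by counting the former twice. *)
Lemma card_toggle (T : finType) (D : {set T}) (s : seq T) : uniq s ->
  #|[set e | (e \in D) (+) (e \in s)]| + 2 * count (mem D) s = #|D| + size s.
Proof.
elim: s D => [|x s IH] D /=.
  by move=> _; rewrite !addn0; apply: eq_card => e; rewrite inE addbF.
move=> /andP[xs us].
pose D' := [set e | (e \in D) (+) (e == x)].
have -> : [set e | (e \in D) (+) (e \in x :: s)]
        = [set e | (e \in D') (+) (e \in s)].
  apply/setP => e; rewrite !inE -addbA; congr (_ (+) _).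
  by case: eqP => //= ->; rewrite (negPf xs).
have /(_ D' us) := IH.
have -> : count (mem D') s = count (mem D) s.
  apply: eq_in_count => e es /=; rewrite inE.
  by case: eqP => [Ee|]; [rewrite -Ee es in xs | rewrite addbF].
have : #|D'| + 2 * (x \in D) = #|D| + 1.
  case xD: (x \in D).
    have -> : D' = D :\ x.
      by apply/setP => e; rewrite !inE; case: eqP => [->|]; rewrite ?xD ?addbF.
    by rewrite (cardsD1 x D) xD; lia.
  have -> : D' = x |: D.
    by apply/setP => e; rewrite !inE; case: eqP => [->|]; rewrite ?xD ?addbF.
  by rewrite cardsU1 xD; lia.
by lia.
Qed.

(** To be used with [K] the star of a vertex, for degrees, and with [K] the set
    of possible bones, for consistency. *)
Lemma flip_card G s H (K : {set {set V}}) : uniq s -> flip G s H ->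
  count (fun e => (e \in K) && (e \in edges G)) s
    = count (fun e => (e \in K) && (e \notin edges G)) s ->
  #|edges H :&: K| = #|edges G :&: K|.
Proof.
move=> us FH bal.
have := card_toggle (edges G :&: K) (filter_uniq (mem K) us).
have -> : [set e | (e \in edges G :&: K) (+) (e \in [seq e <- s | mem K e])]
        = edges H :&: K.
  apply/setP => e; rewrite !inE mem_filter (flipE e FH) /=.
  by case: (e \in K); rewrite ?andbF ?andbT.
rewrite count_filter size_filter.
have E1 : count (predI (mem (edges G :&: K)) (mem K)) s
   = count (fun e => (e \in K) && (e \in edges G)) s.
  by apply: eq_count => e /=; rewrite inE andbC andbCA andbb andbC.
have E2 : count (predI (mem (edges G)) (mem K)) s
   = count (fun e => (e \in K) && (e \in edges G)) s.
  by apply: eq_count => e /=; rewrite andbC.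
have E3 : count (predI (predC (mem (edges G))) (mem K)) s
   = count (fun e => (e \in K) && (e \notin edges G)) s.
  by apply: eq_count => e /=; rewrite andbC.
have E4 : count (mem K) s = count (predI (mem (edges G)) (mem K)) s +
   count (predI (predC (mem (edges G))) (mem K)) s.
  by rewrite -!count_filter count_predC size_filter.
lia.
Qed.

(** * Swaps as flips of alternating 4-cycles *)

Definition cycle4 a b c d : seq {set V} :=
  [:: [set a; b]; [set b; c]; [set c; d]; [set a; d]].

(** Either pair of opposite edges may be the one present in [G]; the swap then
    removes that pair. *)
Definition alternating G a b c d : bool :=
  [&& uniq [:: a; b; c; d], adj G a b == adj G c d, adj G b c == adj G a d
    & adj G a b != adj G b c].

Lemma cycle4_rot a b c d : cycle4 b c d a =i cycle4 a b c d.
Proof.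
move=> e; rewrite !inE ![[set _; a]]setUC.
by case: (e == _) (e == _) (e == _) (e == _) => [] [] [] [].
Qed.

Lemma alternating_rot G a b c d : alternating G b c d a = alternating G a b c d.
Proof.
rewrite /alternating -(rot_uniq 1 [:: a; b; c; d]) /rot /=; congr (_ && _).
rewrite ![adj G _ a]adjC.
by case: (adj G a b) (adj G b c) (adj G c d) (adj G a d) => [] [] [] [].
Qed.

Lemma adj_flip G s H x y : flip G s H ->
  adj H x y = adj G x y (+) ([set x; y] \in s).
Proof. exact: flipE. Qed.

Lemma mem_cycle4 a b c d x y : [set x; y] \in cycle4 a b c d =
  [|| (x == a) && (y == b) || (x == b) && (y == a),
      (x == b) && (y == c) || (x == c) && (y == b),
      (x == c) && (y == d) || (x == d) && (y == c) |
      (x == a) && (y == d) || (x == d) && (y == a)].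
Proof. by rewrite !inE !eq_set2 /=. Qed.

Lemma cycle4_off a b c d x y : x \notin [:: a; c] -> y \notin [:: a; c] ->
  [set x; y] \in cycle4 a b c d = false.
Proof.
rewrite mem_cycle4 !inE => /norP[/negPf-> /negPf->] /norP[/negPf-> /negPf->].
by rewrite ?andbF.
Qed.

Lemma cycle4_notin a b c d x y : x \notin [:: a; b; c; d] ->
  ([set x; y] \in cycle4 a b c d) = false.
Proof.
by rewrite mem_cycle4 !inE !negb_or => /and4P[/negPf-> /negPf-> /negPf-> /negPf->].
Qed.

Lemma cycle4_diag a b c d :
  uniq [:: a; b; c; d] -> ([set a; c] \in cycle4 a b c d) = false.
Proof.
rewrite mem_cycle4 /= !inE !negb_or !eqxx ![_ == a]eq_sym ![c == b]eq_sym !andbT.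
by case/and3P => /and3P[/negPf-> /negPf-> /negPf->] /andP[/negPf-> _] /negPf->.
Qed.

Lemma uniq_cycle4 a b c d : uniq [:: a; b; c; d] -> uniq (cycle4 a b c d).
Proof.
rewrite /= !inE !negb_or !eq_set2 !eqxx /=.
rewrite ![d == _]eq_sym ![c == _]eq_sym ![b == _]eq_sym.
by case/and4P=> /and3P[/negPf-> /negPf-> /negPf->]
  /andP[/negPf-> /negPf->] /negPf->.
Qed.

Lemma uniq_cycle4_cat a b c d e f g h : uniq [:: a; b; c; d; e; f; g; h] ->
  uniq (cycle4 a b c d ++ cycle4 e f g h).
Proof.
rewrite -[[:: a; b; c; d; e; f; g; h]]/([:: a; b; c; d] ++ [:: e; f; g; h]).
rewrite !cat_uniq => /and3P[ua /hasPn dis uc].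
rewrite !uniq_cycle4 // andbT; apply/hasPn => x xs; apply/negP => xs'.
have sub p q r t y : y \in x -> x \in cycle4 p q r t -> y \in [:: p; q; r; t].
  rewrite !inE => yx /or4P[]/eqP E; move: yx; rewrite E !inE;
    by case/orP => ->; rewrite ?orbT.
have [y yx] : exists y, y \in x.
  move: xs; rewrite !inE => /or4P[]/eqP->; [exists e|exists f|exists g|exists e];
    by rewrite set21.
by have /negP := dis _ (sub _ _ _ _ _ yx xs); apply; apply: sub yx xs'.
Qed.

Lemma toggleE (T : finType) (E X Y : {set T}) : X \subset E -> [disjoint Y & E] ->
  (E :|: Y) :\: X = [set e | (e \in E) (+) (e \in X :|: Y)].
Proof.
move=> XE YE; apply/setP => e; rewrite !inE.
case eX: (e \in X); first by rewrite (subsetP XE).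
by case eY: (e \in Y); rewrite ?(disjointFr YE eY) //= orbF addbF.
Qed.

Lemma swap_atE a b c d G H :
  swap_at a b c d G H =
    [&& alternating G a b c d, adj G a b & flip G (cycle4 a b c d) H].
Proof.
rewrite /swap_at /alternating.
rewrite -/(adj G a b) -/(adj G c d) -/(adj G b c) -/(adj G a d).
case: (uniq _) => //=.
case ab: (adj G a b); case cd: (adj G c d) => //=; last by rewrite andbF.
case bc: (adj G b c); case ad: (adj G a d) => //=.
rewrite toggleE; first by rewrite /flip; congr (_ == _); apply/setP => e;
  rewrite !inE; congr (_ (+) _); by do 4!case: (e == _).
- by apply/subsetP => e; rewrite !inE => /orP[]/eqP->.
- rewrite disjoint_subset; apply/subsetP => e.
  by rewrite !inE => /orP[]/eqP->; exact/negbT.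
Qed.

Lemma double_swap_atE a b c d e f g h G H :
  double_swap_at a b c d e f g h G H =
    [&& uniq [:: a; b; c; d; e; f; g; h],
        alternating G a b c d && adj G a b, alternating G e f g h && adj G e f
      & flip G (cycle4 a b c d ++ cycle4 e f g h) H].
Proof.
rewrite /double_swap_at.
rewrite -/(adj G a b) -/(adj G c d) -/(adj G b c) -/(adj G a d).
rewrite -/(adj G e f) -/(adj G g h) -/(adj G f g) -/(adj G e h).
case U: (uniq [:: a; b; c; d; e; f; g; h]) => //.
have := U.
rewrite -[[:: a; b; c; d; e; f; g; h]]/([:: a; b; c; d] ++ [:: e; f; g; h]).
rewrite cat_uniq /alternating => /and3P[-> _ ->].
case ab: (adj G a b); case cd: (adj G c d) => //=; rewrite ?andbF //=.
case bc: (adj G b c); case ad: (adj G a d); rewrite ?andbF //=.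
case ef: (adj G e f); case gh: (adj G g h) => //=; rewrite ?andbF //=.
case fg: (adj G f g); case eh: (adj G e h); rewrite ?andbF //=.
rewrite toggleE.
- rewrite /flip; congr (_ == _); apply/setP => x.
  rewrite !inE; congr (_ (+) _).
  by do 8!case: (x == _).
- by apply/subsetP => x; rewrite !inE -!orbA => /or4P[]/eqP->.
- rewrite disjoint_subset; apply/subsetP => x.
  by rewrite !inE -!orbA => /or4P[]/eqP->; exact/negbT.
Qed.

End Flips.

(** * Preserving moves *)

Section Moves.
Variables (V : finType) (S : skeleton V) (deg : V -> nat).
Hypothesis class2E : class2 S = ~: class1 S.
Implicit Types (G H : graph V) (s : seq {set V}) (a b c d x y v : V).

Definition cross x y : bool := (x \in class1 S) (+) (y \in class1 S).

Definition bones : {set {set V}} :=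
  [set [set u; w] | u in class1 S, w in class2 S].

Lemma crossC x y : cross x y = cross y x.
Proof. exact: addbC. Qed.

Lemma mem_bones x y : ([set x; y] \in bones) = cross x y.
Proof.
rewrite /cross; apply/imset2P/idP => [[u w uU wW /eqP]|].
  move: wW; rewrite class2E inE eq_set2 => /negPf wU.
  by case/orP=> /andP[/eqP-> /eqP->]; rewrite uU wU.
case xU: (x \in _); case yU: (y \in _) => //= _.
  by exists x y; rewrite // class2E inE yU.
by exists y x; rewrite ?class2E ?inE ?xU // setUC.
Qed.

Definition realizes G : bool :=
  [forall v, degree G v == deg v] && consistent S G.

Lemma flip_realizes G s H : uniq s -> flip G s H ->
  (forall K : {set {set V}},
      K = bones \/ (exists v, K = [set e : {set V} | v \in e]) ->
    count (fun e => (e \in K) && (e \in edges G)) s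
      = count (fun e => (e \in K) && (e \notin edges G)) s) ->
  realizes G -> realizes H.
Proof.
move=> us FH bal /andP[/forallP dG /eqP cG]; apply/andP; split.
  apply/forallP => v; rewrite -(eqP (dG v)) /degree.
  have dE F : [set e in edges F | v \in e]
      = edges F :&: [set e : {set V} | v \in e].
    by apply/setP => e; rewrite !inE.
  by rewrite !dE (flip_card us FH) //; apply: bal; right; exists v.
rewrite /consistent /edges_between (flip_card us FH) -/bones ?cG //.
by apply: bal; left.
Qed.

Lemma count_cycle4 G a b c d (K : {set {set V}}) : alternating G a b c d ->
  (count (fun e => (e \in K) && (e \in edges G)) (cycle4 a b c d)
    = if adj G a b then ([set a; b] \in K) + ([set c; d] \in K)
      else ([set b; c] \in K) + ([set a; d] \in K)) *
  (count (fun e => (e \in K) && (e \notin edges G)) (cycle4 a b c d)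
    = if adj G a b then ([set b; c] \in K) + ([set a; d] \in K)
      else ([set a; b] \in K) + ([set c; d] \in K)).
Proof.
case/and4P=> _ /eqP; rewrite /= -/(adj G a b) -/(adj G b c).
rewrite -/(adj G c d) -/(adj G a d) => <- /eqP <-.
by case: (adj G a b) (adj G b c) => [] [] // _;
  rewrite /= ?andbT ?andbF; split; lia.
Qed.

(** Each vertex of a 4-cycle is on one edge of each opposite pair, so flips of
    alternating 4-cycles keep the degrees. *)
Lemma star_cycle4 a b c d v : uniq [:: a; b; c; d] ->
  (v \in [set a; b]) + (v \in [set c; d]) = (v \in [set b; c]) + (v \in [set a; d]).
Proof.
rewrite /= !inE !negb_or.
case/and4P=> /and3P[ab ac ad] /andP[bc bd] cd _.
case: (v =P a) => [->|_]; first by rewrite (negPf ab) (negPf ac) (negPf ad).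
case: (v =P b) => [->|_]; first by rewrite (negPf bc) (negPf bd).
by case: (v =P c) => [->|_]; first by rewrite (negPf cd).
Qed.

Lemma uniq_alternating G a b c d : alternating G a b c d -> uniq [:: a; b; c; d].
Proof. by case/and4P. Qed.

Definition reach := connect (preserving_step S).

Lemma flip_eq G s s' H : s =i s' -> flip G s H = flip G s' H.
Proof. by move=> E; congr (_ == _); apply/setP => e; rewrite !inE E. Qed.

Lemma swap_atW a b c d G H : swap_at a b c d G H -> swap G H.
Proof.
by move=> sw; apply/existsP; exists a; apply/existsP; exists b;
  apply/existsP; exists c; apply/existsP; exists d.
Qed.

Lemma double_swap_atW a b c d e f g h G H :
  double_swap_at a b c d e f g h G H -> double_swap G H.
Proof.
by move=> sw; apply/existsP; exists a; apply/existsP; exists b;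
  apply/existsP; exists c; apply/existsP; exists d;
  apply/existsP; exists e; apply/existsP; exists f;
  apply/existsP; exists g; apply/existsP; exists h.
Qed.

Lemma flip_swap G a b c d H :
  alternating G a b c d -> flip G (cycle4 a b c d) H -> swap G H.
Proof.
move=> alt FH; have [ab|/negPf ab] := boolP (adj G a b).
  by apply: (@swap_atW a b c d); rewrite swap_atE alt ab.
apply: (@swap_atW b c d a); rewrite swap_atE (alternating_rot G a b c d) alt.
rewrite (flip_eq _ _ (cycle4_rot a b c d)) FH andbT /=.
by case/and4P: alt => _ _ _; rewrite ab; case: adj.
Qed.

Lemma flip_double_swap G a b c d e f g h H :
  uniq [:: a; b; c; d; e; f; g; h] ->
  alternating G a b c d -> alternating G e f g h -> adj G a b = adj G e f ->
  flip G (cycle4 a b c d ++ cycle4 e f g h) H -> double_swap G H.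
Proof.
move=> u alt alt' abef FH; have [ab|/negPf ab] := boolP (adj G a b).
  apply: (@double_swap_atW a b c d e f g h).
  by rewrite double_swap_atE u alt alt' -abef ab.
(* The pair of [a b] is absent, so the two swaps start at [b c] and [f g]. *)
apply: (@double_swap_atW b c d a f g h e); rewrite double_swap_atE.
rewrite (alternating_rot G a b c d) (alternating_rot G e f g h) alt alt'.
rewrite (@flip_eq _ _ (cycle4 a b c d ++ cycle4 e f g h)); last first.
  by move=> x; rewrite !mem_cat (cycle4_rot a b c d) (cycle4_rot e f g h).
rewrite FH andbT; apply/and3P; split.
- rewrite (@perm_uniq _ _ [:: a; b; c; d; e; f; g; h]) //.
  rewrite -[[:: b; c; d; a; f; g; h; e]]
    /(rot 1 [:: a; b; c; d] ++ rot 1 [:: e; f; g; h]).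
  apply: (@perm_cat _ _ [:: a; b; c; d] _ [:: e; f; g; h]);
    by rewrite perm_rot.
- by case/and4P: alt => _ _ _; rewrite ab; case: adj.
- by case/and4P: alt' => _ _ _; rewrite -abef ab; case: adj.
Qed.

Lemma alternating_flip G s a b c d H : flip G s H ->
  {subset cycle4 a b c d <= s} -> alternating H a b c d = alternating G a b c d.
Proof.
move=> FH sub; rewrite /alternating; congr (_ && _).
rewrite !(adj_flip _ _ FH) ![[set _; _] \in s]sub ?inE ?eqxx ?orbT //.
rewrite !addbT !eqb_negLR !negbK.
by case: (adj G a b) (adj G b c) => [] [].
Qed.

Lemma step_sym : symmetric (preserving_step S).
Proof.
suff imp G H : preserving_step S G H -> preserving_step S H G.
  by move=> G H; apply/idP/idP; apply: imp.
case/and3P => cG cH sw; rewrite /preserving_step cG cH /=.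
case/orP: sw => [] /existsP[a] /existsP[b] /existsP[c] /existsP[d].
  rewrite swap_atE => /and3P[alt _ FH]; apply/orP; left.
  by apply: (@flip_swap _ a b c d); rewrite ?(flip_sym FH) //
    (alternating_flip FH).
case/existsP=> e /existsP[f] /existsP[g] /existsP[h].
rewrite double_swap_atE => /and4P[u /andP[alt ab] /andP[alt' ef] FH].
apply/orP; right.
apply: (@flip_double_swap _ a b c d e f g h); rewrite ?(flip_sym FH) //.
- by rewrite (alternating_flip FH) // => x; rewrite mem_cat => ->.
- by rewrite (alternating_flip FH) // => x; rewrite mem_cat orbC => ->.
- rewrite !(adj_flip _ _ FH) ab ef !mem_cat.
  by rewrite !inE !eqxx !orbT.
Qed.

Lemma reach_sym G H : reach G H = reach H G.
Proof. exact: (sym_connect_sym step_sym). Qed.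

Lemma realizes_reach G H :
  realizes G -> realizes H -> swap G H || double_swap G H ->
  reach G H.
Proof.
move=> /andP[_ cG] /andP[_ cH] sw.
by apply: connect1; rewrite /preserving_step cG cH.
Qed.

(** The numerical hypothesis says that the opposite pairs of the 4-cycle have
    the same number of crossing edges: the swap keeps the bone count. *)
Lemma flip1 G a b c d : realizes G -> alternating G a b c d ->
  cross a b + cross c d = cross b c + cross a d ->
  exists H, [/\ realizes H, reach G H & flip G (cycle4 a b c d) H].
Proof.
move=> rG alt bal; have u := uniq_alternating alt.
have [|H FH] := @flip_exists _ G (cycle4 a b c d).
  rewrite /= !cards2; move: u; rewrite /= !inE !negb_or.
  by case/and4P=> /and3P[-> _ ->] /andP[-> _] -> _.
have rH : realizes H.
  apply: flip_realizes (uniq_cycle4 u) FH _ rG => K DK.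
  suff E : ([set a; b] \in K) + ([set c; d] \in K)
      = ([set b; c] \in K) + ([set a; d] \in K).
    by rewrite !(count_cycle4 _ alt); case: ifP; rewrite E.
  case: DK => [->|[v ->]]; first by rewrite !mem_bones.
  by move: (star_cycle4 v u); rewrite !(in_set (fun e : {set V} => v \in e)).
by exists H; split=> //; apply: realizes_reach => //; rewrite (flip_swap alt FH).
Qed.

(** Here only the total bone count of the two swaps matters. As the first edges
    [a b] and [e f] have the same status, the pairs removed are those of [a b]
    and [e f], or those of [b c] and [f g]. *)
Lemma flip2 G a b c d e f g h : realizes G ->
  uniq [:: a; b; c; d; e; f; g; h] ->
  alternating G a b c d -> alternating G e f g h -> adj G a b = adj G e f ->
  cross a b + cross c d + (cross e f + cross g h)
    = cross b c + cross a d + (cross f g + cross e h) ->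
  exists H, [/\ realizes H, reach G H
    & flip G (cycle4 a b c d ++ cycle4 e f g h) H].
Proof.
move=> rG u alt alt' abef bal.
have u1 := uniq_alternating alt; have u2 := uniq_alternating alt'.
have [|H FH] := @flip_exists _ G (cycle4 a b c d ++ cycle4 e f g h).
  rewrite /= !cards2; move: u1 u2; rewrite /= !inE !negb_or.
  case/and4P=> /and3P[-> _ ->] /andP[-> _] -> _.
  by case/and4P=> /and3P[-> _ ->] /andP[-> _] -> _.
have rH : realizes H.
  apply: flip_realizes (uniq_cycle4_cat u) FH _ rG => K DK.
  rewrite !count_cat !(count_cycle4 _ alt) !(count_cycle4 _ alt') -abef.
  case: DK => [->|[v ->]].
    by rewrite !mem_bones; case: ifP => _; move: bal; clear; lia.
  move: (star_cycle4 v u1) (star_cycle4 v u2).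
  rewrite !(in_set (fun e : {set V} => v \in e)).
  by case: ifP => _; clear; lia.
exists H; split=> //; apply: realizes_reach => //.
by rewrite (flip_double_swap u alt alt' abef FH) orbT.
Qed.

End Moves.

(** * Neighbourhood comparison *)

(** Neighbourhoods are compared outside [x] and [y], as each of these two
    vertices can only be a neighbour of the other one. By symmetry of [m] this
    exception affects both counts equally. *)
Lemma nbr_card_mono (T : finType) (m : rel T) (x y : T) : symmetric m ->
  (forall v, v != x -> v != y -> m y v -> m x v) ->
  #|[set v | (v != y) && m y v]|
      + [exists v, [&& v != x, v != y, m x v & ~~ m y v]]
    <= #|[set v | (v != x) && m x v]|.
Proof.
move=> msym sub; set A := [set v | _]; set B := [set v | _ && m x v].
have AB : A :\ x \subset B :\ y.
  by apply/subsetP => v; rewrite !inE => /and3P[vx vy yv]; rewrite vx vy sub.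
have E : (x \in A) = (y \in B) by rewrite !inE eq_sym msym.
rewrite (cardsD1 x A) (cardsD1 y B) E -addnA leq_add2l.
case: existsP => [[v /and4P[vx vy xv yv]]|_]; last by rewrite addn0 subset_leq_card.
rewrite addn1; apply: proper_card; rewrite properE AB.
by apply/subsetPn; exists v; rewrite !inE vx vy ?xv ?(negPf yv).
Qed.

(** * Minimal pairs and their red and blue edges *)

Section Core.
Variables (V : finType) (S : skeleton V) (deg : V -> nat).
Hypothesis class2E : class2 S = ~: class1 S.
Implicit Types (G H : graph V) (s : seq {set V}) (a b c d x y v : V).

Local Notation cross := (cross S).
Local Notation reach := (reach S).
Local Notation realizes := (realizes S deg).

Definition diff G H x y := adj G x y (+) adj H x y.

Definition symdiff G H : {set {set V}} :=
  [set e | (e \in edges G) (+) (e \in edges H)].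

Definition dist G H := #|symdiff G H|.

Lemma distC G H : dist G H = dist H G.
Proof. by apply: eq_card => e; rewrite !inE addbC. Qed.

Lemma dist_flip G G' s H : uniq s -> flip G' s H ->
  dist G H + 2 * count (mem (symdiff G G')) s = dist G G' + size s.
Proof.
move=> us FH; rewrite /dist -(card_toggle _ us); congr (_ + _).
by apply: eq_card => e; rewrite !inE (flipE e FH) addbA.
Qed.

Lemma count_symdiff G H a b c d : count (mem (symdiff G H)) (cycle4 a b c d) =
  diff G H a b + diff G H b c + diff G H c d + diff G H a d.
Proof. by rewrite /= !inE addn0 !addnA. Qed.

(** Both graphs may move, since the moves are reversible. *)
Definition minimal G G' := [/\ realizes G, realizes G' &
  forall H H', realizes H -> realizes H' -> reach G H -> reach G' H' ->
    dist G G' <= dist H H'].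

Lemma minimal_sym G G' : minimal G G' -> minimal G' G.
Proof. by case=> rG rG' m; split=> // H H' *; rewrite distC (distC H) m. Qed.

Lemma minimal_flip1 G G' a b c d : minimal G G' -> alternating G' a b c d ->
  cross a b + cross c d = cross b c + cross a d ->
  diff G G' a b + diff G G' b c + diff G G' c d + diff G G' a d <= 2.
Proof.
case=> rG rG' m alt bal; have [H [rH GH FH]] := flip1 class2E rG' alt bal.
have := dist_flip G (uniq_cycle4 (uniq_alternating alt)) FH.
rewrite count_symdiff; have /= := m G H rG rH (connect0 _ _) GH.
set n := _ + diff G G' a d; clear; lia.
Qed.

(** The blue edges are those of [red G' G]. *)
Definition red G G' x y := adj G x y && ~~ adj G' x y.

Lemma redC G G' : symmetric (red G G').
Proof. by move=> x y; rewrite /red !(adjC _ x). Qed.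

Lemma adj_neq G x y : adj G x y -> x != y.
Proof. by apply: contraTneq => ->; rewrite adj_irr. Qed.

Lemma crossD a b c d : cross a d = cross a b (+) cross b c (+) cross c d.
Proof.
rewrite /cross.
by case: (a \in _) (b \in _) (c \in _) (d \in _) => [] [] [] [].
Qed.

(** If [ad] is absent from [G], then [a b c d] can be swapped in [G]; if it is
    in [G'], then in [G']. As [ab] and [bc] have the same type, so have
    [cd] and [ad], and the swap is preserving. Three of its four pairs differ. *)
Lemma red_close G G' a b c d : minimal G G' ->
  red G G' a b -> red G' G b c -> red G G' c d -> a != d ->
  cross a b = cross b c -> red G G' a d.
Proof.
move=> m /andP[ab /negPf ab'] /andP[bc' /negPf bc] /andP[cd /negPf cd'] ad x.
have x' : cross c d = cross a d by rewrite (crossD a b c d) x addbb.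
have u : uniq [:: a; b; c; d].
  rewrite /= !inE !negb_or ad (adj_neq ab) (adj_neq bc') (adj_neq cd) !andbT /=.
  by apply/andP; split; apply/eqP => E; subst; move: bc; rewrite adjC ?ab ?cd.
apply/andP; split.
  apply/negPn/negP => /negPf nad.
  have alt : alternating G a b c d by rewrite /alternating u ab cd bc nad.
  have := minimal_flip1 (minimal_sym m) alt; rewrite x x' => /(_ erefl).
  by rewrite /diff ab ab' bc bc' cd cd' !addnS.
apply/negP => nad.
have alt : alternating G' a b c d by rewrite /alternating u ab' cd' bc' nad.
have := minimal_flip1 m alt; rewrite x x' => /(_ erefl).
by rewrite /diff ab ab' bc bc' cd cd' !addnS.
Qed.

(** By [red_close] the red neighbours of [c] are red neighbours of [a], and [b]
    is one of [a] only. *)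
Lemma red_lt G G' a b c : minimal G G' ->
  red G G' a b -> red G' G b c -> cross a b = cross b c ->
  #|[set v | red G G' c v]| < #|[set v | red G G' a v]|.
Proof.
move=> m ab bc x.
have irr w : [set v | red G G' w v] = [set v | (v != w) && red G G' w v].
  by apply/setP => v; rewrite !inE; case: eqP => // ->; rewrite /red adj_irr.
rewrite !irr -addn1.
apply: leq_trans (nbr_card_mono (y := c) (redC G G') _); last first.
  by move=> v va vc cv; apply: red_close m ab bc cv _ x; rewrite eq_sym.
rewrite leq_add2l lt0b; apply/existsP; exists b.
move: ab bc => /andP[ab ab'] /andP[bc bc'].
by rewrite /red eq_sym (adj_neq ab) (adj_neq bc) ab ab' (adjC G c) (negPf bc').
Qed.

Lemma realizes_balanced G G' v : realizes G -> realizes G' ->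
  #|[set x | red G G' v x]| = #|[set x | red G' G v x]|.
Proof.
move=> /andP[/forallP/(_ v)/eqP dG _] /andP[/forallP/(_ v)/eqP dG' _].
move: dG dG'; rewrite !degreeE.
rewrite -(cardsID [set x | adj G' v x] [set x | adj G v x]) => <-.
rewrite -(cardsID [set x | adj G v x] [set x | adj G' v x]) setIC.
have E F H : [set x | adj F v x] :\: [set x | adj H v x] = [set x | red F H v x].
  by apply/setP => x; rewrite !inE andbC.
by rewrite !E => /addnI.
Qed.

(** By [red_lt], [c] has fewer red edges than [a]; with the two graphs exchanged,
    [a] has fewer blue edges than [c]. But each vertex has as many red as blue
    edges. *)
Lemma red_cross G G' a b c : minimal G G' ->
  red G G' a b -> red G' G b c -> cross b c = ~~ cross a b.
Proof.
move=> m ab bc; case: (eqVneq (cross a b) (cross b c)) => [x|]; last first.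
  by case: (cross b c); case: (cross a b).
have lt1 := red_lt m ab bc x.
have lt2 : #|[set v | red G' G a v]| < #|[set v | red G' G c v]|.
  apply: (red_lt (minimal_sym m) (b := b)); [by rewrite redC | by rewrite redC |].
  by rewrite crossC -x crossC.
case: m => rG rG' _; rewrite !(realizes_balanced _ rG' rG) in lt2.
by rewrite ltnNge ltnW in lt1.
Qed.

Lemma red_other G G' a b : realizes G -> realizes G' -> red G G' a b ->
  exists c, red G' G a c.
Proof.
move=> rG rG' ab.
have : 0 < #|[set x | red G' G a x]|.
  rewrite -realizes_balanced //; apply/card_gt0P; exists b; by rewrite inE.
by case/card_gt0P => c; rewrite inE; exists c.
Qed.

(** Both graphs have the bone count of the skeleton. *)
Lemma red_bones G G' x y : realizes G -> realizes G' ->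
  red G G' x y -> cross x y -> exists u w, red G' G u w /\ cross u w.
Proof.
move=> /andP[_ /eqP cG] /andP[_ /eqP cG'] /andP[xy xy'] cr.
have [/existsP[u /existsP[w /andP[ruw cuw]]]|no] :=
  boolP [exists u, exists w, red G' G u w && cross u w]; first by exists u, w.
have : edges_between G' (class1 S) (class2 S)
     \proper edges_between G (class1 S) (class2 S).
  apply/properP; split; last first.
    exists [set x; y]; first by rewrite inE -/(adj G x y) xy mem_bones.
    by rewrite inE -/(adj G' x y) (negPf xy').
  apply/subsetP => e; rewrite /edges_between !in_setI => /andP[eG' eK].
  rewrite eK andbT; apply/negPn/negP => eG; case/negP: no.
  move: eK eG eG' => /imset2P[u w uU wW ->] eG eG'.
  apply/existsP; exists u; apply/existsP; exists w; rewrite /red /adj eG eG'.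
  by rewrite /cross uU /=; move: wW; rewrite class2E inE => /negPf->.
by move/proper_card; rewrite cG cG' ltnn.
Qed.

(** On a pair where [G] and [G'] differ, the kind tells red inside and blue
    crossing edges from blue inside and red crossing ones. *)
Definition kind G x y := adj G x y (+) cross x y.

Lemma diffC G G' x y : diff G G' x y = diff G G' y x.
Proof. by rewrite /diff !(adjC _ x). Qed.

Lemma diff_red G G' x y : diff G G' x y -> red G G' x y \/ red G' G x y.
Proof. by rewrite /diff /red; case: adj; case: adj; auto. Qed.

Lemma diff_other G G' a b : minimal G G' -> diff G G' a b ->
  exists c, [/\ diff G G' a c, adj G a c = ~~ adj G a b & cross a c = ~~ cross a b].
Proof.
move=> m ab; have [rG rG' _] := m; have m' := minimal_sym m.
case: (diff_red ab) => rab.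
  have [c ac] := red_other rG rG' rab; exists c.
  have -> : cross a c = ~~ cross a b.
    by rewrite (crossC _ a b); apply: red_cross m _ ac; rewrite redC.
  by move: rab ac => /andP[-> _] /andP[u /negPf w]; rewrite /diff u w.
have [c ac] := red_other rG' rG rab; exists c.
have -> : cross a c = ~~ cross a b.
  by rewrite (crossC _ a b); apply: red_cross m' _ ac; rewrite redC.
by move: rab ac => /andP[_ /negPf->] /andP[u /negPf w]; rewrite /diff u w.
Qed.

Lemma diff_cross G G' a b c : minimal G G' -> diff G G' a b -> diff G G' a c ->
  adj G a b != adj G a c -> cross a c = ~~ cross a b.
Proof.
move=> m ab ac ne; rewrite (crossC _ a b).
have [rab|rab] := diff_red ab; have [rac|rac] := diff_red ac.
- by move: rab rac ne => /andP[-> _] /andP[-> _].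
- by apply: (red_cross m _ rac); rewrite redC.
- by apply: (red_cross (minimal_sym m) _ rac); rewrite redC.
- by move: rab rac ne => /andP[_ /negPf->] /andP[_ /negPf->].
Qed.

(** For edges of different colour this is [diff_cross]; two edges of the same
    colour are compared with one of the other colour. *)
Lemma kind_const G G' a b c : minimal G G' -> diff G G' a b -> diff G G' a c ->
  kind G a b = kind G a c.
Proof.
move=> m ab ac.
have ne b' c' : diff G G' a b' -> diff G G' a c' ->
    adj G a b' != adj G a c' -> kind G a b' = kind G a c'.
  move=> h1 h2 h; rewrite /kind (diff_cross m h1 h2 h).
  by case: (adj G a b') (adj G a c') h => [] [] // _; case: (cross a b').
have [E|] := eqVneq (adj G a b) (adj G a c); last exact: ne.
have [d [ad adE _]] := diff_other m ab.
rewrite (ne b d) // ?adE; last by case: (adj G a b).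
by apply/esym/ne; rewrite // -E adE; case: (adj G a b).
Qed.

Lemma cross_neq x y : cross x y -> x != y.
Proof. by apply: contraTneq => ->; rewrite /cross addbb. Qed.

(** * The edges of one kind, with a swap to spare in the other *)

Section Part.
Variables (G G' : graph V) (p : bool).
Hypothesis mGG' : minimal G G'.

(** Among the differing pairs of kind [p], those that cross are present in [G']
    iff [p], and those inside a class are present in [G'] iff [~~ p]. *)
Definition outer x y := [&& cross x y, adj G x y == ~~ p & adj G' x y == p].
Definition inner x y := [&& ~~ cross x y, adj G x y == p & adj G' x y == ~~ p].
Definition in_part x := exists y, diff G G' x y /\ kind G x y = p.

Lemma outerC x y : outer x y = outer y x.
Proof. by rewrite /outer crossC !(adjC _ x). Qed.

Lemma innerC x y : inner x y = inner y x.
Proof. by rewrite /inner crossC !(adjC _ x). Qed.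

Lemma outer_part x y : outer x y -> diff G G' x y /\ kind G x y = p.
Proof.
rewrite /diff /kind => /and3P[-> /eqP-> /eqP->].
by rewrite addbT negbK; case: p.
Qed.

Lemma inner_part x y : inner x y -> diff G G' x y /\ kind G x y = p.
Proof.
rewrite /diff /kind => /and3P[/negPf-> /eqP-> /eqP->].
by rewrite addbF; case: p.
Qed.

Lemma part_outer x y : diff G G' x y -> kind G x y = p -> cross x y -> outer x y.
Proof.
rewrite /diff /kind /outer => + + xy; rewrite xy.
by case: (adj G x y) (adj G' x y) p => [] [] [].
Qed.

Lemma part_inner x y : diff G G' x y -> kind G x y = p -> ~~ cross x y -> inner x y.
Proof.
rewrite /diff /kind /inner => + + /negPf xy; rewrite xy.
by case: (adj G x y) (adj G' x y) p => [] [] [].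
Qed.

Lemma outer_inner x y : outer x y -> exists z, inner x z.
Proof.
move=> o; have [dxy kxy] := outer_part o; have /and3P[cxy _ _] := o.
have [z [dxz _ cxz]] := diff_other mGG' dxy; exists z.
by apply: part_inner; rewrite ?cxz ?cxy // (kind_const mGG' dxz dxy).
Qed.

Lemma inner_outer x y : inner x y -> exists z, outer x z.
Proof.
move=> o; have [dxy kxy] := inner_part o; have /and3P[cxy _ _] := o.
have [z [dxz _ cxz]] := diff_other mGG' dxy; exists z.
by apply: part_outer; rewrite ?cxz ?cxy // (kind_const mGG' dxz dxy).
Qed.

(** A pair inside a class at a vertex of the part would have the other kind if
    it had status [p] in [G'] only. *)
Lemma common_inside x y :
  in_part x -> ~~ cross x y -> adj G' x y = p -> adj G x y = p.
Proof.
move=> [z [dxz kxz]] /negPf cxy axy; apply/eqP; apply: contraTT isT => ne.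
have dxy : diff G G' x y by rewrite /diff axy; case: (adj G x y) p ne => [] [].
move: (kind_const mGG' dxy dxz); rewrite kxz /kind cxy addbF => E.
by rewrite E eqxx in ne.
Qed.

Lemma common_across x y :
  in_part x -> cross x y -> adj G' x y = ~~ p -> adj G x y = ~~ p.
Proof.
move=> [z [dxz kxz]] cxy axy; apply/eqP; apply: contraTT isT => ne.
have dxy : diff G G' x y by rewrite /diff axy; case: (adj G x y) p ne => [] [].
move: (kind_const mGG' dxy dxz); rewrite kxz /kind cxy addbT => E.
by rewrite -E negbK eqxx in ne.
Qed.

(** A 4-cycle away from the part of kind [p] whose flip in [G'] decreases the
    distance but is not preserving: it exchanges two inside pairs of status
    [p] with two crossing pairs of status [~~ p]. *)
Definition spare e f g h := [/\ alternating G' e f g h, adj G' e f = p,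
  [/\ cross e f = false, cross f g, cross g h = false & cross e h],
  2 < diff G G' e f + diff G G' f g + diff G G' g h + diff G G' e h
  & {in [:: e; f; g; h], forall x, ~ in_part x}].

Variables e f g h : V.
Hypothesis sp : spare e f g h.

(** The 4-cycle [b c d z] has crossing pairs of status [p] and inside pairs of
    status [~~ p], opposite to the spare one, so that both can be flipped by one
    double swap. The spare flip gains at least 2 and the other one gains twice
    its number of differing pairs minus 4; the total cannot exceed what
    was lost between [G'] and [H]. *)
Lemma spare_flip2 H b c d z : realizes H -> reach G' H ->
  {in [:: e; f; g; h] &, forall x y, adj H x y = adj G' x y} ->
  {in [:: b; c; d; z], forall x, in_part x} ->
  alternating H b c d z -> adj H b c = p ->
  cross b c -> cross c d = false -> cross d z ->
  dist G G' + 2 * (diff G H b c + diff G H c d + diff G H d z + diff G H b z)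
    <= dist G H + 2.
Proof.
case: sp => altN efp [xef xfg xgh xeh] cnt off rH GH agree part alt bcp xbc xcd xdz.
have xbz : cross b z = false by rewrite (crossD b c d z) xbc xcd xdz.
have iN : [&& e \in [:: e; f; g; h], f \in [:: e; f; g; h], g \in [:: e; f; g; h]
    & h \in [:: e; f; g; h]] by rewrite !inE !eqxx !orbT.
case/and4P: iN => ie jf ig ih.
have altH : alternating H e f g h by rewrite /alternating !agree.
have u : uniq [:: b; c; d; z; e; f; g; h].
  rewrite -[[:: b; c; d; z; e; f; g; h]]/([:: b; c; d; z] ++ [:: e; f; g; h]).
  rewrite cat_uniq (uniq_alternating alt) (uniq_alternating altN) andbT.
  by apply/hasPn => x /off np; apply/negP => /part.
have [||K [rK HK FK]] := flip2 class2E rH u alt altH.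
- by rewrite (agree e f) // efp.
- by rewrite xbc xcd xdz xbz xef xfg xgh xeh.
have := dist_flip G (uniq_cycle4_cat u) FK.
rewrite count_cat !count_symdiff size_cat [size _ + _]/=.
have E : diff G H e f + diff G H f g + diff G H g h + diff G H e h
       = diff G G' e f + diff G G' f g + diff G G' g h + diff G G' e h.
  by rewrite /diff !agree.
rewrite E; case: mGG' => rG _ /(_ G K rG rK (connect0 _ _) (connect_trans GH HK)).
move: cnt; set n := _ + _; set q := (X in _ * (X + _)); clear; lia.
Qed.

Lemma part_of_outer x y : outer x y -> in_part x.
Proof. by move/outer_part; exists y. Qed.

Lemma part_of_inner x y : inner x y -> in_part x.
Proof. by move/inner_part; exists y. Qed.

Lemma flip_off a b c d H : in_part a -> in_part c -> flip G' (cycle4 a b c d) H ->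
  {in [:: e; f; g; h] &, forall x y, adj H x y = adj G' x y}.
Proof.
case: sp => _ _ _ _ off pa pc FH x y /off xN /off yN.
rewrite (adj_flip _ _ FH) cycle4_off ?addbF //.
  by rewrite !inE; apply/norP; split; apply/eqP => E; apply: xN; rewrite E.
by rewrite !inE; apply/norP; split; apply/eqP => E; apply: yN; rewrite E.
Qed.

(** The vertex itself is excluded since, when [p] is [false], it would be counted
    as one of its own non-neighbours. *)
Definition nbrs v : nat :=
  #|[set x | (x != v) && (~~ cross v x && (adj G' v x == p))]|.

(** Otherwise [b c d z] could be flipped along with the spare 4-cycle, and at
    least three of its pairs differ. *)
Lemma outer_inner_outer b c d z :
  outer b c -> inner c d -> outer d z -> b != z -> adj G' b z = p.
Proof.
move=> bc cd dz bz; apply/eqP; apply: contraTT isT => ne.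
have /and3P[xbc /eqP Gbc /eqP Hbc] := bc.
have /and3P[/negPf xcd /eqP Gcd /eqP Hcd] := cd.
have /and3P[xdz /eqP Gdz /eqP Hdz] := dz.
have xbz : cross b z = false by rewrite (crossD b c d z) xbc xcd xdz.
have Hbz : adj G' b z = ~~ p by case: (adj G' b z) p ne => [] [].
have u : uniq [:: b; c; d; z].
  rewrite /= !inE !negb_or bz (cross_neq xbc) (cross_neq xdz) !andbT /=.
  apply/and3P; split; apply/eqP => E; subst.
  - by rewrite crossC xcd in xbc.
  - by move: Gcd Hcd; rewrite !adj_irr; case: p.
  - by rewrite crossC xcd in xdz.
have alt : alternating G' b c d z.
  by rewrite /alternating u Hbc Hcd Hdz Hbz !eqxx; case: p.
have [_ rG' _] := mGG'.
have part : {in [:: b; c; d; z], forall x, in_part x}.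
  move=> x; rewrite !inE => /or4P[]/eqP->.
  - exact: part_of_outer bc.
  - exact: part_of_inner cd.
  - exact: part_of_outer dz.
  - by rewrite outerC in dz; exact: part_of_outer dz.
have := spare_flip2 rG' (connect0 _ _) (fun _ _ _ _ => erefl) part alt Hbc xbc
  xcd xdz.
rewrite /diff Gbc Hbc Gcd Hcd Gdz Hdz.
have -> : (~~ p (+) p) = true by case: p.
have -> : (p (+) ~~ p) = true by case: p.
by rewrite leq_add2l; case: (_ (+) _).
Qed.

(** The preliminary flip of [a v w t] costs at most 4, less than the joint gain of
    the second flip and the spare one when all pairs of [b c d z] differ. *)
Lemma shifted_flip2 a v w t H b c d z :
  in_part a -> in_part w -> realizes H -> reach G' H ->
  uniq [:: a; v; w; t] -> flip G' (cycle4 a v w t) H ->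
  {in [:: b; c; d; z], forall x, in_part x} ->
  alternating H b c d z -> adj H b c = p ->
  cross b c -> cross c d = false -> cross d z ->
  diff G H b c && diff G H c d && diff G H d z && diff G H b z = false.
Proof.
move=> pa pw rH GH u FH part alt bcp xbc xcd xdz.
have := spare_flip2 rH GH (flip_off pa pw FH) part alt bcp xbc xcd xdz.
have := dist_flip G (uniq_cycle4 u) FH; rewrite [size _]/=.
move: (count _ _) (diff G H b c) (diff G H c d) (diff G H d z) (diff G H b z).
by clear => n [] [] [] [] //=; lia.
Qed.

Lemma nbrs_sym : symmetric (fun v x => ~~ cross v x && (adj G' v x == p)).
Proof. by move=> x y; rewrite crossC adjC. Qed.

(** If [v] is counted for [y] but not for [b], then flipping [y v b z], which lies
    in one class, makes [bz] differ, and then [b c d z] consists of differing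
    pairs only. The inequality is strict because of [z]. *)
Lemma nbrs_lt b c d z y :
  outer b c -> inner c d -> outer d z -> inner z y -> b != z -> nbrs y < nbrs b.
Proof.
move=> bc cd dz zy bz.
have Hbz := outer_inner_outer bc cd dz bz.
have pb := part_of_outer bc; have pd := part_of_outer dz.
have pc := part_of_inner cd; have pz := part_of_inner zy.
have py : in_part y by apply: (part_of_inner (y := z)); rewrite innerC.
have /and3P[xbc /eqP Gbc /eqP Hbc] := bc.
have /and3P[/negPf xcd /eqP Gcd /eqP Hcd] := cd.
have /and3P[xdz /eqP Gdz /eqP Hdz] := dz.
have /and3P[/negPf xzy /eqP Gzy /eqP Hzy] := zy.
have xbz : cross b z = false by rewrite (crossD b c d z) xbc xcd xdz.
have Gbz : adj G b z = p by apply: common_inside; rewrite ?xbz.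
have yz : y != z by apply/eqP => E; move: Gzy Hzy; rewrite E !adj_irr; case: p.
have yb : y != b.
  by apply/eqP => E; move: Hzy; rewrite E adjC Hbz; case: p.
rewrite -addn1; apply: leq_trans (nbr_card_mono (y := y) nbrs_sym _).
  rewrite leq_add2l lt0b; apply/existsP; exists z.
  by rewrite eq_sym bz eq_sym yz xbz Hbz eqxx crossC xzy adjC Hzy; case: p.
move=> v vb vy /andP[/negPf xyv /eqP Hyv].
have xbv : cross b v = false by rewrite (crossD b z y v) xbz xzy xyv.
rewrite xbv /=; apply: contraTT isT => ne.
have Hvb : adj G' v b = ~~ p by rewrite adjC; case: (adj G' b v) p ne => [] [].
have zv : z != v by apply/eqP => E; move: Hyv; rewrite -E adjC Hzy; case: p.
have u : uniq [:: y; v; b; z].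
  by rewrite /= !inE !negb_or eq_sym vy yb yz vb eq_sym zv bz.
have Hyz : adj G' y z = ~~ p by rewrite adjC.
have alt : alternating G' y v b z.
  by rewrite /alternating u Hyv Hbz Hvb Hyz !eqxx; case: p.
have [_ rG' _] := mGG'.
have [|H [rH GH FH]] := flip1 class2E rG' alt.
  by rewrite xyv xbz (crossC _ v b) xbv (crossC _ y z) xzy.
have off x : cross b x -> x \notin [:: y; v; b; z].
  move=> xbx; rewrite !inE !negb_or.
  by apply/and4P; split; apply/eqP => E; move: xbx;
    rewrite E ?xbv ?xbz ?(crossD b z z y) ?xbz ?xzy /cross ?addbb.
have xbd : cross b d.
  by rewrite (crossD b b c d) /cross addbb -/(cross b c) -/(cross c d) xbc xcd.
have AH x x' : adj H x x' = adj G' x x' (+) ([set x; x'] \in cycle4 y v b z).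
  exact: adj_flip FH.
have Abc : adj H b c = p by rewrite adjC AH cycle4_notin ?off // addbF adjC.
have Acd : adj H c d = ~~ p by rewrite AH cycle4_notin ?off // addbF.
have Adz : adj H d z = p by rewrite AH cycle4_notin ?off // addbF.
have Abz : adj H b z = ~~ p by rewrite AH Hbz !inE eqxx !orbT addbT.
have u2 : uniq [:: b; c; d; z].
  rewrite /= !inE !negb_or bz (cross_neq xbc) (cross_neq xbd) (cross_neq xdz) andbT.
  rewrite (@cross_neq c z) ?(crossD c d d z) ?xcd ?xdz /cross ?addbb // !andbT /=.
  by apply/eqP => E; move: Gcd Hcd; rewrite E !adj_irr; case: p.
have alt2 : alternating H b c d z.
  by rewrite /alternating u2 Abc Acd Adz Abz !eqxx; case: p.
have part : {in [:: b; c; d; z], forall x, in_part x}.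
  by move=> x; rewrite !inE => /or4P[]/eqP->.
have := shifted_flip2 py pb rH GH u FH part alt2 Abc xbc xcd xdz.
by rewrite /diff Gbc Abc Gcd Acd Gdz Adz Gbz Abz; case: p.
Qed.

(** Otherwise [b d c y] could be flipped along with the spare 4-cycle. *)
Lemma triangle_common b c d y :
  outer b c -> outer b d -> inner c d -> inner b y -> adj G' y c = ~~ p.
Proof.
move=> bc bd cd iby; apply/eqP; apply: contraTT isT => ne.
have Hyc : adj G' y c = p by case: (adj G' y c) p ne => [] [].
have [_ rG' _] := mGG'.
have pb := part_of_outer bc; have pc := part_of_inner cd.
have pd : in_part d by apply: (part_of_inner (y := c)); rewrite innerC.
have py : in_part y by apply: (part_of_inner (y := b)); rewrite innerC.
have /and3P[xbc /eqP Gbc /eqP Hbc] := bc.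
have /and3P[xbd /eqP Gbd /eqP Hbd] := bd.
have /and3P[/negPf xcd /eqP Gcd /eqP Hcd] := cd.
have /and3P[/negPf xby /eqP Gby /eqP Hby] := iby.
have xyc : cross y c.
  by rewrite (crossD y b b c) (crossC _ y b) xby xbc /cross addbb.
have xyd : cross y d.
  by rewrite (crossD y b b d) (crossC _ y b) xby xbd /cross addbb.
have u : uniq [:: b; d; c; y].
  rewrite /= !inE !negb_or (cross_neq xbd) (cross_neq xbc).
  rewrite ![_ == y]eq_sym (cross_neq xyc) (cross_neq xyd) !andbT /=.
  apply/andP; split; apply/eqP => E.
    by move: Gby Hby; rewrite E !adj_irr; case: p.
  by move: Gcd Hcd; rewrite E !adj_irr; case: p.
have xdc : cross d c = false by rewrite crossC.
have xcy : cross c y by rewrite crossC.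
have Hdc : adj G' d c = ~~ p by rewrite adjC.
have Hcy : adj G' c y = p by rewrite adjC.
have alt : alternating G' b d c y.
  by rewrite /alternating u Hbd Hdc Hcy Hby !eqxx; case: p.
have part : {in [:: b; d; c; y], forall x, in_part x}.
  by move=> x; rewrite !inE => /or4P[]/eqP->.
have := spare_flip2 rG' (connect0 _ _) (fun _ _ _ _ => erefl) part alt Hbd xbd
  xdc xcy.
rewrite /diff Gbd Hbd (adjC G d c) Gcd Hdc Gby Hby.
have -> : (~~ p (+) p) = true by case: p.
have -> : (p (+) ~~ p) = true by case: p.
by rewrite leq_add2l; case: (_ (+) _).
Qed.

(** If [v] is counted for [y] but not for [b], then flipping [y v b c] is
    preserving, as [v] and [y] are in the class of [b], and makes [yc] differ; then
    [b d c y] consists of differing pairs only. *)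
Lemma nbrs_triangle b c d y :
  outer b c -> outer b d -> inner c d -> inner b y -> nbrs y <= nbrs b.
Proof.
move=> bc bd cd iby.
have Hyc := triangle_common bc bd cd iby.
have [_ rG' _] := mGG'.
have pb := part_of_outer bc; have pc := part_of_inner cd.
have pd : in_part d by apply: (part_of_inner (y := c)); rewrite innerC.
have py : in_part y by apply: (part_of_inner (y := b)); rewrite innerC.
have /and3P[xbc /eqP Gbc /eqP Hbc] := bc.
have /and3P[xbd /eqP Gbd /eqP Hbd] := bd.
have /and3P[/negPf xcd /eqP Gcd /eqP Hcd] := cd.
have /and3P[/negPf xby /eqP Gby /eqP Hby] := iby.
have xyc : cross y c.
  by rewrite (crossD y b b c) (crossC _ y b) xby xbc /cross addbb.
have xyd : cross y d.
  by rewrite (crossD y b b d) (crossC _ y b) xby xbd /cross addbb.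
have Gyc : adj G y c = ~~ p by apply: common_across.
have nyb : y != b by apply/eqP => E; move: Gby Hby; rewrite E !adj_irr; case: p.
apply: leq_trans (leq_addr _ _) (nbr_card_mono (y := y) nbrs_sym _).
move=> v vb vy /andP[/negPf xyv /eqP Hyv].
have xbv : cross b v = false by rewrite (crossD b b y v) xby xyv /cross addbb.
rewrite xbv /=; apply: contraTT isT => ne.
have Hvb : adj G' v b = ~~ p by rewrite adjC; case: (adj G' b v) p ne => [] [].
have xvc : cross v c.
  by rewrite (crossD v b b c) (crossC _ v b) xbv xbc /cross addbb.
have u : uniq [:: y; v; b; c].
  rewrite /= !inE !negb_or eq_sym vy nyb vb.
  by rewrite (cross_neq xyc) (cross_neq xvc) (cross_neq xbc).
have alt : alternating G' y v b c.
  by rewrite /alternating u Hyv Hbc Hvb Hyc !eqxx; case: p.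
have [|H [rH GH FH]] := flip1 class2E rG' alt.
  by rewrite xyv xbc (crossC _ v b) xbv xyc.
have AH x x' : adj H x x' = adj G' x x' (+) ([set x; x'] \in cycle4 y v b c).
  exact: adj_flip FH.
have dc : d != c by apply/eqP => E; move: Gcd Hcd; rewrite E !adj_irr; case: p.
have xvd : cross v d.
  by rewrite (crossD v b b d) (crossC _ v b) xbv xbd /cross addbb.
have dN : d \notin [:: y; v; b; c].
  by rewrite !inE !negb_or dc ![d == _]eq_sym !cross_neq.
have Abd : adj H b d = p by rewrite adjC AH cycle4_notin // addbF adjC.
have Adc : adj H d c = ~~ p by rewrite AH cycle4_notin // addbF adjC.
have Acy : adj H c y = p by rewrite adjC AH Hyc !inE eqxx !orbT addbT negbK.
have Aby : adj H b y = ~~ p by rewrite adjC AH cycle4_diag // addbF adjC.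
have xdc : cross d c = false by rewrite crossC.
have xcy : cross c y by rewrite crossC.
have u2 : uniq [:: b; d; c; y].
  rewrite /= !inE !negb_or (cross_neq xbd) (cross_neq xbc) dc (eq_sym b) nyb.
  by rewrite (eq_sym d) (cross_neq xyd) (cross_neq xcy).
have alt2 : alternating H b d c y.
  by rewrite /alternating u2 Abd Adc Acy Aby !eqxx; case: p.
have part : {in [:: b; d; c; y], forall x, in_part x}.
  by move=> x; rewrite !inE => /or4P[]/eqP->.
have := shifted_flip2 py pb rH GH u FH part alt2 Abd xbd xdc xcy.
rewrite /diff Gbd Abd Adc Acy Gby Aby (adjC G d c) Gcd (adjC G c y) Gyc.
by case: p.
Qed.

(** Continue the walk by t1 -o- s2 -i- t2 -o- s3 -i- t3. It cannot return twice:
    if s2 = t0 and s3 = t1, then t2 t1 would contradict [triangle_common]. *)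
Lemma nbrs_descent (t0 s1 t1 : V) : outer t0 s1 -> inner s1 t1 ->
  exists t2 s3 t3 : V,
    [/\ outer t2 s3, inner s3 t3 & nbrs t2 + nbrs t3 < nbrs t0 + nbrs t1].
Proof.
move=> o1 i1; have i1' : inner t1 s1 by rewrite innerC.
have [s2 o2] := inner_outer i1'.
have o2' : outer s2 t1 by rewrite outerC.
have [t2 i2] := outer_inner o2'.
have i2' : inner t2 s2 by rewrite innerC.
have [s3 o3] := inner_outer i2'.
have o3' : outer s3 t2 by rewrite outerC.
have [t3 i3] := outer_inner o3'.
exists t2, s3, t3; split=> //.
have [E|ne] := eqVneq t0 s2; last first.
  have lt1 := nbrs_lt o1 i1 o2 i2 ne.
  suff : nbrs t3 <= nbrs t1 by move: lt1; clear; lia.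
  have [E'|ne'] := eqVneq t1 s3; last exact: ltnW (nbrs_lt o2 i2 o3 i3 ne').
  by subst s3; apply: nbrs_triangle o2 _ i2 i3; rewrite outerC.
subst s2.
have le1 : nbrs t2 <= nbrs t0 by apply: nbrs_triangle o1 _ i1 i2; rewrite outerC.
suff : nbrs t3 < nbrs t1 by move: le1; clear; lia.
apply: (nbrs_lt o2 i2 o3 i3); apply/eqP => E; subst s3.
have := triangle_common o2' o1 i1' i2.
by move: o3 => /and3P[_ _ /eqP->]; case: p.
Qed.

Lemma no_outer x y : ~ outer x y.
Proof.
move=> oxy.
have [z ixz] : exists z, inner y z.
  by apply: outer_inner; rewrite outerC; exact: oxy.
have [n] := ubnP (nbrs x + nbrs z).
elim: n x y z oxy ixz => // n IH x y z oxy iyz le.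
have [t2 [s3 [t3 [o i lt]]]] := nbrs_descent oxy iyz.
by apply: IH o i _; move: lt le; clear; lia.
Qed.

End Part.

(** * Conclusion *)

Lemma kind_sym G G' x y : diff G G' x y -> kind G' x y = ~~ kind G x y.
Proof. by rewrite /diff /kind; case: adj (adj G' x y) (cross x y) => [] [] []. Qed.

Lemma diff_graphC G G' x y : diff G G' x y = diff G' G x y.
Proof. exact: addbC. Qed.

(** Inside edges [eu] and [wh] of the colour opposite to [uw] exist by balance.
    The pair [eh] crosses, so by [kind_const] it does not have the colour of
    these two. It therefore closes the path to an alternating 4-cycle in one of
    the two graphs. *)
Lemma spare_exists G G' u w : minimal G G' -> diff G G' u w -> cross u w ->
  (exists e f g h, spare G G' (adj G u w) e f g h) \/
  (exists e f g h, spare G' G (~~ adj G u w) e f g h).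
Proof.
move=> m duw xuw; have m' := minimal_sym m.
move Dp: (adj G u w) => p.
have [e [due Gue xue]] := diff_other m duw.
have dwu : diff G G' w u by rewrite diffC.
have [h [dwh Gwh xwh]] := diff_other m dwu.
rewrite xuw /= in xue; rewrite (crossC _ w u) xuw /= in xwh.
rewrite (adjC G w u) Dp in Gwh; rewrite Dp in Gue.
have Geu : adj G e u = ~~ p by rewrite adjC.
have deu : diff G G' e u by rewrite diffC.
have dhw : diff G G' h w by rewrite diffC.
have xeu : cross e u = false by rewrite crossC.
have xeh : cross e h by rewrite (crossD e u w h) xeu xuw xwh.
have flp x y : diff G G' x y -> adj G' x y = ~~ adj G x y.
  by rewrite /diff; case: adj (adj G' x y) => [] [].
have G'eu : adj G' e u = p by rewrite flp // Geu negbK.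
have G'wh : adj G' w h = p by rewrite flp // Gwh negbK.
have G'uw : adj G' u w = ~~ p by rewrite flp // Dp.
have un : uniq [:: e; u; w; h].
  rewrite /= !inE !negb_or (cross_neq xuw) (cross_neq xeh) !andbT.
  have xew : cross e w by rewrite (crossD e u u w) xeu xuw /cross addbb.
  have xuh : cross u h by rewrite (crossD u w w h) xuw xwh /cross addbb.
  rewrite (cross_neq xew) (cross_neq xuh) !andbT /=.
  by apply/andP; split; apply/eqP => E; move: Geu G'eu Gwh G'wh;
    rewrite E !adj_irr; move: (p) => [].
have kinds x : x \in [:: e; u; w; h] ->
    exists2 y, diff G G' x y & kind G x y = ~~ p.
  rewrite !inE => /or4P[]/eqP->.
  - by exists u => //; rewrite /kind Geu xeu addbF.
  - by exists e => //; rewrite /kind Gue xue addbF.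
  - by exists h => //; rewrite /kind Gwh xwh addbF.
  - by exists w => //; rewrite /kind adjC Gwh crossC xwh addbF.
have [G'eh|G'eh] := eqVneq (adj G' e h) (~~ p).
  left; exists e, u, w, h; split=> //.
  - by rewrite /alternating un G'eu G'wh G'uw G'eh !eqxx; move: (p) => [].
  - by rewrite deu duw dwh.
  - move=> x /kinds[y dxy kxy] [z [dxz]].
    by rewrite (kind_const m dxz dxy) kxy; move: (p) => [].
have {}G'eh : adj G' e h = p by move: (adj G' e h) (p) G'eh => [] [].
have Geh : adj G e h = p.
  apply/eqP; apply: contraTT isT => ne.
  have {}ne : adj G e h = ~~ p by move: (adj G e h) (p) ne => [] [].
  have deh : diff G G' e h by rewrite /diff ne G'eh; move: (p) => [].
  have := kind_const m deh deu; rewrite /kind ne xeh Geu xeu addbT addbF.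
  by move: (p) => [].
right; exists e, u, w, h; split=> //.
- by rewrite /alternating un Geu Gwh Dp Geh !eqxx; move: (p) => [].
- by rewrite !(diff_graphC G' G) deu duw dwh.
- move=> x /kinds[y dxy kxy] [z []]; rewrite diff_graphC => dxz.
  rewrite (kind_sym dxz) (kind_const m dxz dxy) kxy; by move: (p) => [].
Qed.

(** Balance at a vertex yields a crossing edge, the bone count one of the other
    colour, that is, of the other kind. One of them gives the spare 4-cycle, and
    [no_outer] forbids the other one. *)
Lemma minimal_eq G G' : minimal G G' -> G = G'.
Proof.
move=> m; have [rG rG' _] := m.
suff no x y : ~~ diff G G' x y.
  apply: val_inj; apply/setP => e /=; apply/idP/idP => ein;
    have /cards2P[x [y [_ De]]] := edge_card2 ein; rewrite De in ein *;
    have := no x y; rewrite /diff /adj ein.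
  - by case: (_ \in _).
  - by case: (_ \in _).
apply/negP => dxy.
have [u [w [duw xuw]]] : exists u w, diff G G' u w /\ cross u w.
  have [xxy|/negPf xxy] := boolP (cross x y); first by exists x, y.
  have [z [dxz _]] := diff_other m dxy; rewrite xxy => xxz.
  by exists x, z.
have [u' [w' [Guw' Guw'' xuw']]] : exists u' w',
    [/\ adj G u' w' = ~~ adj G u w, adj G' u' w' = adj G u w & cross u' w'].
  have [r|r] := diff_red duw.
    have [u' [w' [/andP[r' /negPf r''] x']]] := red_bones rG rG' r xuw.
    by exists u', w'; move: r => /andP[-> _].
  have [u' [w' [/andP[r' /negPf r''] x']]] := red_bones rG' rG r xuw.
  by exists u', w'; move: r => /andP[_ /negPf->].
case: (spare_exists m duw xuw) => -[e [f [g [h sp]]]].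
  apply: (no_outer m sp (x := u') (y := w')).
  by rewrite /outer xuw' Guw' Guw'' !eqxx.
apply: (no_outer (minimal_sym m) sp (x := u') (y := w')).
by rewrite /outer xuw' Guw' Guw'' negbK !eqxx.
Qed.

Lemma realizations_connected G G' : realizes G -> realizes G' -> reach G G'.
Proof.
move=> rG rG'.
pose P (F : graph V * graph V) :=
  [&& realizes F.1, realizes F.2, reach G F.1 & reach G' F.2].
have PG : P (G, G') by rewrite /P /= rG rG' /reach !connect0.
have [[H H'] /and4P[rH rH' GH GH'] minH] :=
  arg_minnP (fun F => dist F.1 F.2) PG.
have m : minimal H H'.
  split=> // K K' rK rK' HK HK'; apply: (minH (K, K')).
  by rewrite /P /= rK rK' /reach (connect_trans GH HK) (connect_trans GH' HK').
apply: connect_trans GH _; rewrite (minimal_eq m) -/(reach H' G') reach_sym.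
exact: GH'.
Qed.

End Core.

Theorem theorem3p4 (V : finType) (U W : {set V}) (k : nat) (d : V -> nat)
    (hpart : partition [set U; W] [set: V]) (hUW : U != W)
    (G G' : graph V)
    (hG : has_degree_sequence d G) (hG' : has_degree_sequence d G')
    (cG : consistent (skeleton_of d U W k) G)
    (cG' : consistent (skeleton_of d U W k) G') :
  exists s : seq (graph V),
    path (preserving_step (skeleton_of d U W k)) G s /\ last G s = G'.
Proof.
have WE : W = ~: U.
  move: hpart => /and3P[/eqP cov /trivIsetP triv _].
  have dis : [disjoint U & W] by apply: triv => //; rewrite !inE eqxx ?orbT.
  apply/eqP; rewrite eqEsubset; apply/andP; split.
    by apply/subsetP => x xW; rewrite inE (disjointFl dis xW).
  apply/subsetP => x; rewrite inE => /negPf xU.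
  have : x \in cover [set U; W] by rewrite cov inE.
  by rewrite /cover bigcup_setU !big_set1 inE xU.
have re F : has_degree_sequence d F -> consistent (skeleton_of d U W k) F ->
    realizes (skeleton_of d U W k) d F.
  by move=> dF cF; rewrite /realizes cF andbT; apply/forallP => v; rewrite dF.
have /connectP[s ps ->] := realizations_connected (S := skeleton_of d U W k) WE
  (re _ hG cG) (re _ hG' cG').
by exists s.
Qed.
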